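(* Let $\Lambda$ and $\Gamma$ be countable discrete groups. Suppose that $\Lambda$ is bi-exact and that $\Lambda \hookrightarrow \Gamma$ is an existential embedding, and identify $\Lambda$ with its image in $\Gamma$. Then $\Lambda$ is an a-normal subgroup of $\Gamma$; that is, for every $g \in \Gamma \setminus \Lambda$ the group $\Lambda \cap g\Lambda g^{-1}$ is amenable.
   Context: Existential embedding: an embedding of groups $H \hookrightarrow G$ is existential if for every existential first-order sentence $\phi$ in the language of groups with constants from $H$, i.e. every sentence of the form $\exists x_1 \cdots \exists x_n\, \psi(x_1,\dots,x_n)$ with $\psi$ a quantifier-free formula (a Boolean combination of equations between words in the variables, elements of $H$, and inverses), one has $G \models \phi$ if and only if $H \models \phi$. Bi-exact: a countable discrete group $\Lambda$ is bi-exact if the action of $\Lambda \times \Lambda$ by left/right translations, the continuous extension of $(s,t)\cdot x = s x t^{-1}$, on the Stone–Čech remainder $\partial^\beta \Lambda := \beta\Lambda \setminus \Lambda$ is (topologically) amenable. This means that there is a sequence of continuous maps $\mu^n : \partial^\beta\Lambda \to \mathrm{Prob}(\Lambda\times\Lambda)$, $x \mapsto \mu^n_x$, such that for every $s \in \Lambda\times\Lambda$, $$\lim_{n\to\infty} \sup_{x \in \partial^\beta\Lambda} \| s\cdot \mu^n_x - \mu^n_{s\cdot x}\|_1 = 0,$$ where $\mathrm{Prob}(\Lambda\times\Lambda) = \{\mu \in \ell^1(\Lambda\times\Lambda) : \mu \ge 0,\ \|\mu\|_1 = 1\}$ (with the topology of pointwise convergence, which agrees on this set with the $\ell^1$-norm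 topology) and $(s\cdot\mu)(t) = \mu(s^{-1}t)$. a-normal: a subgroup $\Lambda$ of a countable group $\Gamma$ is a-normal if $\Lambda \cap g\Lambda g^{-1}$ is amenable for each $g \in \Gamma\setminus\Lambda$. *)

(* Defs.v *)
From HB Require Import structures.
From mathcomp Require Import all_boot all_order all_algebra.
From mathcomp Require Import all_classical all_reals all_analysis.

Set Implicit Arguments.
Unset Strict Implicit.
Unset Printing Implicit Defensive.

Import Order.TTheory GRing.Theory Num.Theory.
Import numFieldNormedType.Exports.

Local Open Scope classical_set_scope.
Local Open Scope ring_scope.

(* Terms and quantifier-free formulas of the language of groups, with
   constants from H and n variables. *)
Inductive gterm (H : Type) (n : nat) : Type :=
| TVar of 'I_n
| TCst of H
| TOne
| TMul of gterm H n & gterm H n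
| TInv of gterm H n.

Inductive qf_formula (H : Type) (n : nat) : Type :=
| FEq of gterm H n & gterm H n
| FNot of qf_formula H n
| FAnd of qf_formula H n & qf_formula H n
| FOr of qf_formula H n & qf_formula H n.

Fixpoint term_eval (H : Type) (n : nat) (G : groupType)
    (c : H -> G) (v : 'I_n -> G) (t : gterm H n) : G :=
  match t with
  | TVar i => v i
  | TCst h => c h
  | TOne => 1%g
  | TMul t1 t2 => (term_eval c v t1 * term_eval c v t2)%g
  | TInv t1 => ((term_eval c v t1)^-1)%g
  end.

Fixpoint qf_holds (H : Type) (n : nat) (G : groupType)
    (c : H -> G) (v : 'I_n -> G) (psi : qf_formula H n) : Prop :=
  match psi with
  | FEq t1 t2 => term_eval c v t1 = term_eval c v t2
  | FNot p => ~ qf_holds c v p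
  | FAnd p q => qf_holds c v p /\ qf_holds c v q
  | FOr p q => qf_holds c v p \/ qf_holds c v q
  end.

(* G |= exists x_1 ... x_n, psi, where h : H is interpreted as c h. *)
Definition sat_exists (H : Type) (n : nat) (G : groupType)
    (c : H -> G) (psi : qf_formula H n) : Prop :=
  exists v : 'I_n -> G, qf_holds c v psi.

Definition existential_embedding (H G : groupType)
    (iota : {multiplicative H -> G}) : Prop :=
  injective iota /\
  forall (n : nat) (psi : qf_formula H n),
    sat_exists iota psi <-> sat_exists (@id H) psi.

(* The Stone-Cech compactification of the discrete space T: the ultrafilters
   on T, with the topology whose basic open sets are {x | A \in x}, for A a
   subset of T; T embeds in it by principal ultrafilters. *)
Record beta (T : Type) := Beta {
  beta_sets :> set_system T;
  beta_ultra : UltraFilter beta_sets }.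

Lemma beta_eq (T : Type) (x y : beta T) :
  beta_sets x = beta_sets y -> x = y.
Proof.
case: x y => [F FU] [G GU] /= FG; rewrite FG in FU *.
by rewrite (Prop_irrelevance FU GU).
Qed.

HB.instance Definition _ (T : Type) := gen_eqMixin (beta T).
HB.instance Definition _ (T : Type) := gen_choiceMixin (beta T).

Definition beta_base (T : Type) (A : set T) : set (beta T) :=
  [set x | beta_sets x A].

Lemma beta_base_cover (T : Type) :
  \bigcup_(A in [set: set T]) beta_base A = setT.
Proof.
apply/seteqP; split=> // x _; exists setT => //=.
by have := beta_ultra x => ?; exact: filterT.
Qed.

Lemma beta_base_join (T : Type) (A B : set T) (x : beta T) :
  [set: set T] A -> [set: set T] B -> beta_base A x -> beta_base B x ->
  exists C, [/\ [set: set T] C, beta_base C x &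
                beta_base C `<=` beta_base A `&` beta_base B].
Proof.
move=> _ _ xA xB; exists (A `&` B); split=> //.
  by have := beta_ultra x => ?; exact: filterI.
move=> y yAB; have yU := beta_ultra y.
by split; apply: filterS yAB => z [].
Qed.

HB.instance Definition _ (T : Type) := isBaseTopological.Build (beta T)
  (@beta_base_cover T) (@beta_base_join T).

Definition principal (T : Type) (t : T) : beta T :=
  Beta (principal_filter_ultra t).

(* The remainder beta T \ T. *)
Definition remainder (T : Type) : set (beta T) := ~` range (@principal T).

Lemma fmap_ultra (T U : Type) (f : T -> U) (F : set_system T) :
  UltraFilter F -> UltraFilter (f @ F).
Proof.
move=> FU; split; first exact: fmap_proper_filter.
move=> G GF sFG; apply/seteqP; split=> // A GA.
have [//|FnA] := in_ultra_setVsetC (f @^-1` A) FU.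
have GnA : G (~` A) by exact: sFG.
by have /filter_ex [? []] : G (A `&` ~` A) by exact: filterI.
Qed.

(* The continuous extension beta T -> beta U of f : T -> U. *)
Definition beta_map (T U : Type) (f : T -> U) (x : beta T) : beta U :=
  Beta (fmap_ultra f (beta_ultra x)).

Lemma open_beta_base (T : Type) (A : set T) : open (beta_base A).
Proof. by exists [set A] => //; rewrite bigcup_set1. Qed.

Lemma nbhs_betaP (T : Type) (x : beta T) (V : set (beta T)) :
  nbhs x V <-> exists2 A, beta_sets x A & beta_base A `<=` V.
Proof.
split.
  rewrite nbhsE => -[W [[D _ <-] [A DA xA]] sWV]; exists A => //.
  by apply: subset_trans sWV => y yA; exists A.
move=> [A xA sAV]; apply: filterS sAV _.
by apply: open_nbhs_nbhs; split=> //; exact: open_beta_base.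
Qed.

Lemma beta_map_principal (T U : Type) (f : T -> U) (t : T) :
  beta_map f (principal t) = principal (f t).
Proof.
by apply: beta_eq; apply/seteqP; split=> A /principal_filterP ?;
  apply/principal_filterP.
Qed.

Lemma beta_map_continuous (T U : Type) (f : T -> U) : continuous (beta_map f).
Proof.
move=> x V /nbhs_betaP [A xA sAV]; apply/nbhs_betaP.
by exists (f @^-1` A) => // y yA; exact: sAV.
Qed.

Lemma principal_dense (T : Type) : dense (range (@principal T)).
Proof.
move=> O [x Ox] oO.
have /nbhs_betaP[A xA sAO] : nbhs x O by exact: open_nbhs_nbhs.
have xU := beta_ultra x; have [t At] := filter_ex xA.
by exists (principal t); split; [apply/sAO/principal_filterP|exists t].
Qed.

Lemma beta_compact (T : Type) : compact [set: beta T].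
Proof.
rewrite compact_ultra => F FU _.
pose x : set_system T := [set A | F (beta_base A)].
have xU : UltraFilter x.
  have xF : ProperFilter x.
    apply: Build_ProperFilter_ex.
      move=> A xA; have [y yA] := @filter_ex _ F _ _ xA.
      by have yU := beta_ultra y; exact: filter_ex yA.
    split.
    - apply: (@filterS _ F _ setT); last exact: filterT.
      by move=> y _; have yU := beta_ultra y; exact: filterT.
    - move=> A B FA FB; apply: (@filterS _ F _ _ _ _ (@filterI _ F _ _ _ FA FB)) => y [yA yB].
      by have yU := beta_ultra y; exact: filterI.
    - move=> A B sAB; apply: (@filterS _ F) => y yA.
      by have yU := beta_ultra y; exact: filterS yA.
  split=> // G GF sxG; apply/seteqP; split=> // A GA.
  have [//|FnA] := in_ultra_setVsetC (beta_base A) FU.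
  have : G (~` A).
    apply: sxG; apply: (@filterS _ F _ _ _ _ FnA) => y nyA.
    by have [|] := in_ultra_setVsetC A (beta_ultra y).
  by move=> GnA; have /filter_ex [? []] : G (A `&` ~` A) by exact: filterI.
exists (Beta xU); split=> //= V /nbhs_betaP [A xA sAV].
exact: filterS sAV xA.
Qed.

Lemma beta_hausdorff (T : Type) : hausdorff_space (beta T).
Proof.
move=> x y clxy; apply/esym/beta_eq.
have [xU yU] := (beta_ultra x, beta_ultra y).
apply: max_filter => A xA; have [//|ynA] := in_ultra_setVsetC A yU.
have xN : nbhs x (beta_base A) by apply/nbhs_betaP; exists A.
have yN : nbhs y (beta_base (~` A)) by apply/nbhs_betaP; exists (~` A).
have [z [zA znA]] := clxy _ _ xN yN; have zU := beta_ultra z.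
by have /filter_ex [? []] : beta_sets z (A `&` ~` A) by exact: filterI.
Qed.

(* The universal property of the Stone-Cech compactification. *)
Lemma beta_extension (T : Type) (K : topologicalType) (f : T -> K) :
  compact [set: K] -> hausdorff_space K ->
  exists2 g : beta T -> K, continuous g & forall t, g (principal t) = f t.
Proof.
move=> cK hK.
have ex_lim (x : beta T) : exists p : K, f @ beta_sets x --> p.
  have fU := fmap_ultra f (beta_ultra x).
  by move: cK; rewrite compact_ultra => /(_ _ fU filterT) [p [_ ?]]; exists p.
have [g gP] := choice ex_lim; exists g.
  move=> x V gV.
  have [W gW sWV] := compact_regular hK cK filterT gV.
  apply/nbhs_betaP; exists (f @^-1` W); first exact: gP.
  move=> y yW; apply: sWV => Z gZ; have yU := beta_ultra y.
  have yZ : beta_sets y (f @^-1` Z) by exact: gP.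
  by have [t [? ?]] := filter_ex (filterI yW yZ); exists (f t).
move=> t; apply/esym/hK => V W fV gW.
have /principal_filterP ? := gP (principal t) _ gW.
by exists (f t); split=> //; exact: nbhs_singleton.
Qed.

(* The continuous extension to beta L of (s, t) . x = s x t^-1. *)
Definition lr_act (L : groupType) (s : L * L) : beta L -> beta L :=
  beta_map (fun x : L => (s.1 * x * s.2^-1)%g).

Lemma lr_act_remainder (L : groupType) (s : L * L) (x : beta L) :
  remainder x -> remainder (lr_act s x).
Proof.
move=> nx [t _ tE]; apply: nx; pose f (y : L) := (s.1^-1 * (y * s.2))%g.
exists (f t) => //; rewrite -beta_map_principal tE.
transitivity (beta_map (fun y => f (s.1 * y * s.2^-1)%g) x); apply: beta_eq=> //.
by rewrite (_ : (fun y => _) = id)//; apply/funext => y; rewrite /f mulgVK mulKg.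
Qed.

Section BiExact.
Context (R : realType).

Definition l1norm (T : choiceType) (f : T -> R) : \bar R :=
  \esum_(t in [set: T]) (`|f t|)%:E.

Definition Prob (T : choiceType) : set {ptws T -> R} :=
  [set m | (forall t, 0 <= m t) /\ l1norm m = 1%E].

Definition translate (G : groupType) (s : G) (m : {ptws G -> R}) :
    {ptws G -> R} := fun t => m (s^-1 * t)%g.

(* Only the restrictions of the mu n to the remainder matter.  The supremum is
   that of a set of nonnegative quantities, taken in [0, +oo]: adjoining 0
   makes it 0, and not -oo, when the remainder is empty, i.e. when L is
   finite. *)
Definition bi_exact (L : groupType) : Prop :=
  exists mu : nat -> beta L -> {ptws (L * L)%type -> R},
    [/\ forall n x, remainder x -> Prob (mu n x),
        forall n, {within @remainder L, continuous (mu n)} &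
        forall s : (L * L)%type,
          (fun n => ereal_sup (0%E |`
             [set l1norm (translate s (mu n x) \- mu n (lr_act s x))
               | x in @remainder L])) @ \oo --> 0%E].

(* Amenability of the discrete group K, a subgroup of G: there is a finitely
   additive, left-invariant probability measure on all subsets of K.  The
   values of m on sets that are not contained in K are irrelevant. *)
Definition amenable_subgroup (G : groupType) (K : set G) : Prop :=
  exists m : set G -> R,
    [/\ m K = 1,
        forall A, A `<=` K -> 0 <= m A,
        forall A B, A `<=` K -> B `<=` K -> A `&` B = set0 ->
          m (A `|` B) = m A + m B &
        forall (k : G) A, K k -> A `<=` K ->
          m [set (k * a)%g | a in A] = m A].

Definition conj_set (G : groupType) (g : G) (H : set G) : set G :=
  [set (g * h * g^-1)%g | h in H].

Definition a_normal (G : groupType) (H : set G) : Prop :=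
  forall g : G, ~ H g -> amenable_subgroup (H `&` conj_set g H).

End BiExact.

(* Main.v *)
(** For g outside L let K be the intersection of L and g L g^-1, and let
    phi k = g^-1 k g.  The equations k x (phi k)^-1 = x, for finitely many k
    in K, together with finitely many inequations x <> e with e in L, are
    solved in G by x = g, hence are solvable in L.  By compactness some point
    z of the remainder of beta L is fixed by all the (k, phi k).  At z the
    almost equivariant measures of bi-exactness become almost invariant under
    this copy of K in L x L; an ultralimit of their images under a
    K-equivariant map L x L -> K is an invariant mean. *)

Require Import Defs.
From mathcomp Require Import all_boot all_order all_algebra.
From mathcomp Require Import all_classical all_reals all_analysis.

Import Order.TTheory GRing.Theory Num.Theory.
Import numFieldNormedType.Exports.

Set Implicit Arguments.
Unset Strict Implicit.
Unset Printing Implicit Defensive.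

Local Open Scope classical_set_scope.

Lemma fixed_remainder_point (L G : groupType) (iota : {multiplicative L -> G})
    (g : G) :
  existential_embedding iota -> ~ range iota g ->
  exists2 z : beta L, remainder z &
    forall s : L * L, (iota s.1 * g = g * iota s.2)%g -> lr_act s z = z.
Proof.
move=> [_ iotaE] gL.
pose good (s : L * L) := (iota s.1 * g = g * iota s.2)%g.
(* An index is a finite list of equations together with a finite list of excluded elements. [D]
   admits the lists whose equations hold at [g], and [B i] is the solution set in [L]. *)
pose D := [set i : seq (L * L) * seq L | forall s, s \in i.1 -> good s].
pose B (i : seq (L * L) * seq L) := [set x : L |
  (forall s, s \in i.1 -> s.1 * x = x * s.2)%g /\ x \notin i.2].
have BD i : D i -> B i !=set0.
  case: i => ps es; rewrite /D /= => Dps.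
  pose X : gterm L 1 := TVar L ord0.
  pose fe := foldr (fun e p => FAnd (FNot (FEq X (TCst 1 e))) p)
    (FEq (TOne L 1) (TOne L 1)) es.
  pose f := foldr
    (fun (s : L * L) p =>
       FAnd (FEq (TMul (TCst 1 s.1) X) (TMul X (TCst 1 s.2))) p) fe ps.
  (* This is stated for every interpretation, since it is used twice: in [G] at the point [g], and
     in [L] to read off a solution. *)
  have fP (H : groupType) (c : L -> H) (v : 'I_1 -> H) : qf_holds c v f <->
      (forall s, s \in ps -> c s.1 * v ord0 = v ord0 * c s.2)%g /\
      (forall e, e \in es -> v ord0 <> c e).
    have feP : qf_holds c v fe <-> (forall e, e \in es -> v ord0 <> c e).
      rewrite /fe; elim: es {fe f} => [|e es IH]; first by split.
      rewrite /=; split=> [[ve /IH ves] e'|ves].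
        by rewrite inE => /predU1P[->//|/ves].
      split; first by apply: ves; rewrite mem_head.
      by apply/IH => e' e'es; apply: ves; rewrite inE e'es orbT.
    rewrite /f; elim: ps {f Dps} => [|s ps IH] /=.
      by rewrite feP; split=> [|[]].
    split=> [[vs /IH[vps ves]]|[vps ves]].
      by split=> // s'; rewrite inE => /predU1P[->//|/vps].
    split; first by apply: vps; rewrite mem_head.
    by apply/IH; split=> // s' s'ps; apply: vps; rewrite inE s'ps orbT.
  have [v /fP[vps ves]] : sat_exists (@id L) f.
    apply/iotaE; exists (fun _ => g); apply/fP; split=> [s /Dps//|e _ ge].
    by apply: gL; exists e.
  by exists (v ord0); split=> //; apply/negP => /ves.
have FF : ProperFilter (filter_from D B).
  apply: filter_from_proper BD; apply: filter_from_filter.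
    by exists ([::], [::]).
  (* Concatenating the lists puts the new solution set inside both old ones. *)
  move=> [ps es] [ps' es'] Dp Dp'; exists (ps ++ ps', es ++ es').
    by move=> s /=; rewrite mem_cat => /orP[/Dp|/Dp'].
  move=> x [/= xp]; rewrite mem_cat negb_or => /andP[xe xe'].
  by split; split=> // s sp; apply: xp; rewrite mem_cat sp ?orbT.
have [z [zU Fz]] := ultraFilterLemma FF.
exists (Beta zU).
  (* The principal ultrafilter at [t] cannot contain the set of elements different from [t]. *)
  move=> [t _ [zE]].
  have : z (B ([::], [:: t])) by apply: Fz; exists ([::], [:: t]).
  by rewrite -zE => /principal_filterP[_]; rewrite inE eqxx.
move=> s gs; apply: beta_eq => /=.
have zs : z (B ([:: s], [::])).
  by apply: Fz; exists ([:: s], [::]) => // s'; rewrite inE => /eqP->.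
(* By maximality one inclusion suffices. The translation by [s] fixes each solution of its equation,
   and these solutions form a set in [z]. *)
apply: max_filter => A zA.
have zAs : z (A `&` B ([:: s], [::])) by exact: filterI.
apply: (@filterS _ z _ _ _ _ zAs) => x [Ax [/(_ s (mem_head _ _)) sx _]] /=.
by rewrite sx mulgK.
Qed.

(** The mean is pushed forward: a set is measured by its preimage in [K]. *)
Lemma amenable_subgroup_image (R : realType) (G H : groupType) (f : G -> H)
    (K : set G) :
  (forall x y, f (x * y) = f x * f y)%g ->
  (forall x y, K x -> K y -> K (x * y)%g) -> (forall x, K x -> K x^-1%g) ->
  amenable_subgroup R K -> amenable_subgroup R (f @` K).
Proof.
move=> fM KM KV [m [mK m0 mD mJ]].
exists (fun A => m (K `&` f @^-1` A)); split.
- rewrite (_ : _ `&` _ = K)//; apply/seteqP; split=> [x []//|x Kx].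
  by split=> //; exists x.
- by move=> A _; apply: m0 => x [].
- move=> A B _ _ AB; rewrite preimage_setU setIUr mD//; try by move=> x [].
  by rewrite setIACA -preimage_setI AB preimage_set0 setI0.
- move=> _ A [k Kk <-] sA; rewrite -[RHS](mJ k (K `&` f @^-1` A))//.
  congr m; apply/seteqP; split=> [x [Kx [a Aa fx]]|_ [x [Kx Ax] <-]] /=.
    exists (k^-1 * x)%g; last by rewrite mulVKg.
    split; first by apply: KM => //; exact: KV.
    rewrite /preimage/= (_ : f _ = a)//; apply: (mulgI (f k)).
    by rewrite -fM mulVKg.
  by split; [exact: KM|exists (f x)].
Qed.

Section Reiter.
Context {R : realType}.
Local Open Scope ring_scope.

(** [fine] would send an infinite sum to 0; for a probability measure the sum is finite, by
    [esum_massE]. *)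
Definition mass (T : choiceType) (m : T -> R) (A : set T) : R :=
  fine (\esum_(t in A) (m t)%:E).

Lemma esum_massE (T : choiceType) (m : T -> R) (A : set T) :
  @Prob R T m -> (\esum_(t in A) (m t)%:E)%E = (mass m A)%:E.
Proof.
move=> [m0 m1]; rewrite /mass fineK//.
rewrite ge0_fin_numE; last by apply: esum_ge0 => t _; rewrite lee_fin.
apply: (@le_lt_trans _ _ (l1norm m)); last by rewrite m1 ltry.
rewrite esum_mkcond; apply: le_esum => t _.
by case: ifP => _; rewrite lee_fin ?normr_ge0// ler_norm.
Qed.

Lemma mass_ge0 (T : choiceType) (m : T -> R) (A : set T) :
  @Prob R T m -> 0 <= mass m A.
Proof.
by move=> [m0 _]; apply: fine_ge0; apply: esum_ge0 => t _; rewrite lee_fin.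
Qed.

Lemma massT (T : choiceType) (m : T -> R) : @Prob R T m -> mass m setT = 1.
Proof.
move=> Pm; apply: EFin_inj; rewrite -esum_massE//; case: Pm => m0 <-.
by apply: eq_esum => t _; rewrite ger0_norm.
Qed.

Lemma massU (T : choiceType) (m : T -> R) (A B : set T) :
  @Prob R T m -> A `&` B = set0 -> mass m (A `|` B) = mass m A + mass m B.
Proof.
move=> Pm AB; apply: EFin_inj; rewrite EFinD -!esum_massE//.
rewrite (esumID A); last by move=> t _; rewrite lee_fin; case: Pm.
congr (_ + _)%E; first by rewrite setUK.
congr (esum _ _); rewrite setIUl setICr set0U.
by apply/setIidPl => t Bt At; have : (A `&` B) t by []; rewrite AB.
Qed.

Lemma mass_le1 (T : choiceType) (m : T -> R) (A : set T) :
  @Prob R T m -> mass m A <= 1.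
Proof.
move=> Pm; rewrite -(massT Pm) -(setUv A) massU ?setICr//.
by rewrite lerDl mass_ge0.
Qed.

(** Sum [u t <= v t + |u t - v t|] over [A], let the error run over all of [T], then exchange the
    two measures. *)
Lemma le_dist_mass (T : choiceType) (m m' : T -> R) (A : set T) :
  @Prob R T m -> @Prob R T m' ->
  ((`|mass m A - mass m' A|)%:E <= l1norm (m \- m')%R)%E.
Proof.
have half (u v : T -> R) : @Prob R T u -> @Prob R T v ->
    ((mass u A)%:E <= (mass v A)%:E + l1norm (u \- v)%R)%E.
  move=> Pu Pv; rewrite -!esum_massE// [X in (X <= _)%E]esum_mkcond.
  rewrite [X in (_ <= X + _)%E]esum_mkcond -esumD; first last.
  - by move=> t _; rewrite lee_fin.
  - by move=> t _; case: ifP => // _; rewrite lee_fin; case: Pv.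
  apply: le_esum => t _; case: ifP => _; last by rewrite add0e lee_fin.
  by rewrite -EFinD lee_fin -lerBlDl ler_norm.
move=> Pm Pm'; have := half _ _ Pm Pm'; have := half _ _ Pm' Pm.
have -> : l1norm (m' \- m)%R = l1norm (m \- m')%R.
  by apply: eq_esum => t _ /=; rewrite distrC.
case: (l1norm _) => [r| |] //; last by move=> _ _; rewrite leey.
by rewrite -!EFinD !lee_fin ler_norml lerNl opprB -!lerBlDl => -> ->.
Qed.

Lemma Prob_translate (G : groupType) (s : G) (m : G -> R) :
  @Prob R G m -> @Prob R G (translate s m).
Proof.
move=> [m0 m1]; split=> [t|]; first exact: m0.
rewrite -m1 [RHS](@reindex_esum R G G setT setT (fun t => s^-1 * t)%g)//.
split=> // [t t' _ _|t _]; first exact: mulgI.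
by exists (s * t)%g => //; rewrite mulKg.
Qed.

Lemma mass_lcoset (G : groupType) (s : G) (m : G -> R) (A : set G) :
  mass m [set (s * a)%g | a in A] = mass (translate s^-1%g m) A.
Proof.
rewrite /mass esum_image; last by move=> x y _ _; exact: mulgI.
by congr fine; apply: eq_esum => t _; rewrite /translate invgK.
Qed.

(** Let [r t] be a chosen representative of the right coset [K t]. It depends only on the coset, so
    [t * (r t)^-1] lies in [K] and commutes with left multiplication by [K]. *)
Lemma equivariant_retraction (G : groupType) (K : set G) :
  K 1%g ->
  (forall x y, K x -> K y -> K (x * y)%g) -> (forall x, K x -> K x^-1%g) ->
  exists2 p : G -> G, forall t, K (p t) &
    forall k t, K k -> p (k * t)%g = (k * p t)%g.
Proof.
move=> K1 KM KV; pose r t := xget 1%g [set u | K (t * u^-1)%g].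
exists (fun t => t * (r t)^-1)%g => [t|k t Kk].
  by apply: (@xgetPex _ _ [set u | K (t * u^-1)%g]); exists t; rewrite /= mulgV.
rewrite -mulgA; congr (_ * (_ * _^-1))%g; congr xget.
apply/seteqP; split=> u /=; rewrite -mulgA; last exact: KM.
by move=> /(KM _ _ (KV _ Kk)); rewrite mulKg.
Qed.

Lemma bounded_ultra_cvg (T : Type) (U : set_system T) (u : T -> R) (a b : R) :
  UltraFilter U -> (forall t, a <= u t <= b) -> cvg (u @ U).
Proof.
move=> UU uab.
have := @segment_compact R a b; rewrite compact_ultra.
move=> /(_ _ (fmap_ultra u UU))[|l [_ ul]]; last by apply/cvg_ex; exists l.
have UT : U setT by exact: filterT.
by apply: (@filterS _ U _ _ _ _ UT) => t _; rewrite /= in_itv /= uab.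
Qed.

Lemma amenable_of_almost_invariant (G : groupType) (K : set G)
    (nu : nat -> G -> R) :
  K 1%g ->
  (forall x y, K x -> K y -> K (x * y)%g) -> (forall x, K x -> K x^-1%g) ->
  (forall n, @Prob R G (nu n)) ->
  (forall k, K k ->
    (fun n => l1norm (translate k (nu n) \- nu n)) @ \oo --> 0%E) ->
  amenable_subgroup R K.
Proof.
move=> K1 KM KV Pnu nuK.
have [p pK pE] := equivariant_retraction K1 KM KV.
(* Along an ultrafilter refining [\oo] all bounded sequences converge, and limits at infinity are
   kept. *)
have [U [UU ooU]] := @ultraFilterLemma nat \oo _.
pose w A n := mass (nu n) (p @^-1` A).
have cw A : cvg (w A @ U).
  apply: (@bounded_ultra_cvg _ _ _ 0 1) => n.
  by rewrite mass_ge0//= mass_le1.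
exists (fun A => lim (w A @ U)); split.
- rewrite (_ : w K = cst 1); first exact: lim_cst.
  apply/funext => n; rewrite /w (_ : p @^-1` K = setT) ?massT//.
  by apply/seteqP; split=> // t _; exact: pK.
- by move=> A _; apply: limr_ge => //; apply: nearW => n; exact: mass_ge0.
- move=> A B _ _ AB; rewrite -limD//; congr (lim (_ @ U)); apply/funext => n.
  by rewrite /w preimage_setU massU// -preimage_setI AB preimage_set0.
- move=> k A Kk _; set kA := (X in w X).
  have pkA : p @^-1` kA = [set (k * t)%g | t in p @^-1` A].
    apply/seteqP; split=> [t [a Aa pt]|_ [t At <-]].
      exists (k^-1 * t)%g; last by rewrite mulVKg.
      by rewrite /preimage /= pE -?pt ?mulKg//; exact: KV.
    by exists (p t) => //; rewrite pE.
  (* The mass of a set translated by [k] is the mass of the set under the measure translated by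
     [k^-1], so almost invariance is applied at [k^-1]. *)
  have dw : (w kA - w A) @ U --> (0 : R).
    apply: (@cvg_trans _ ((w kA - w A) @ \oo)).
      by apply: cvg_app; exact: ooU.
    apply/norm_cvg0P; apply: (fine_cvg (f := fun n => (`|(w kA - w A) n|)%:E)).
    apply: (@squeeze_cvge _ _ _ _ (cst 0%E)); last exact: nuK (KV _ Kk).
      apply: nearW => n; rewrite lee_fin normr_ge0 /=.
      have -> : (w kA - w A) n =
          mass (translate k^-1%g (nu n)) (p @^-1` A) - mass (nu n) (p @^-1` A).
        by rewrite -mass_lcoset -pkA.
      by apply: le_dist_mass => //; exact: Prob_translate.
    exact: cvg_cst.
  apply/eqP; rewrite -subr_eq0; apply/eqP.
  have := limB (cw kA) (cw A) => <-.
  exact: cvg_lim dw.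
Qed.

(** At a point fixed by [s], the term of the supremum in bi-exactness compares [mu n z] with its own
    translate by [s]. *)
Lemma amenable_stabilizer (L : groupType) (z : beta L) (K : set (L * L)%type) :
  bi_exact R L -> remainder z ->
  K 1%g ->
  (forall x y, K x -> K y -> K (x * y)%g) -> (forall x, K x -> K x^-1%g) ->
  (forall s, K s -> lr_act s z = z) ->
  amenable_subgroup R K.
Proof.
move=> [mu [muP _ mu0]] zr K1 KM KV zK.
apply: (@amenable_of_almost_invariant _ K (fun n => mu n z)) => //.
  by move=> n; exact: muP.
move=> k Kk; apply: squeeze_cvge (mu0 k); last exact: cvg_cst.
apply: nearW => n; apply/andP; split.
  by apply: esum_ge0 => t _; rewrite lee_fin.
by apply: ereal_sup_ubound; right; exists z => //; rewrite zK.
Qed.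

End Reiter.

Theorem mainTheorem1 (R : realType) (L G : groupType)
    (iota : {multiplicative L -> G}) :
  countable [set: L] -> countable [set: G] ->
  bi_exact R L -> existential_embedding iota ->
  a_normal R (range iota).
Proof.
move=> _ _ bL eL g gL.
have [z zr zfix] := fixed_remainder_point eL gL.
(* Here [K] is the graph of conjugation by [g^-1]: the pairs [(x, y)] in [L * L] for which [iota x]
   is the conjugate of [iota y] by [g]. *)
pose K := [set s : L * L | (iota s.1 * g = g * iota s.2)%g].
have iota1 : iota 1%g = 1%g by apply: (mulgI (iota 1%g)); rewrite -gmulfM !mulg1.
have iotaV x : iota x^-1%g = (iota x)^-1%g.
  by apply: (mulgI (iota x)); rewrite -gmulfM !mulgV.
have K1 : K 1%g by rewrite /K /= iota1 mul1g mulg1.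
have KM x y : K x -> K y -> K (x * y)%g.
  by rewrite /K /= !gmulfM => Kx Ky; rewrite -mulgA Ky !mulgA Kx.
have KV x : K x -> K x^-1%g.
  rewrite /K /= !iotaV => Kx; apply: (mulgI (iota x.1)).
  by rewrite mulVKg mulgA Kx mulgK.
(* The first projection carries the graph onto the intersection, so amenability passes to it. *)
have <- : (iota \o fst) @` K = range iota `&` conj_set g (range iota).
  apply/seteqP; split=> [_ [s Ks <-]|_ [[x _ <-] [_ [y _ <-] xy]]].
    split; first by exists s.1.
    by exists (iota s.2); [exists s.2|rewrite -Ks mulgK].
  by exists (x, y); rewrite // /K /= -xy mulgVK.
apply: amenable_subgroup_image => //; first by move=> x y /=; rewrite gmulfM.
exact: amenable_stabilizer bL zr K1 KM KV zfix.
Qed.
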